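(* Let $(\mathscr{H},\mathscr{C})$ be a continuous field of Hilbert spaces over a topological space $X$, let $(T_\alpha)_{\alpha\in A}$ be a net in $\mathsf{S}(\mathscr{H})$ and $T_\infty\in\mathsf{S}(\mathscr{H})$. Then $$T_\alpha\xrightarrow{\mathsf{srs}}T_\infty\iff T_\alpha\xrightarrow{G}T_\infty .$$
   Context: A section of a family $\mathscr{H}=(\mathscr{H}_x)_{x\in X}$ of Hilbert spaces is a map $f$ on $X$ with $f(x)\in\mathscr{H}_x$; $\Gamma(\mathscr{H})$ is the vector space of sections; $\mathscr{H}$ is also identified with the disjoint union $\bigsqcup_x\mathscr{H}_x$ with projection $\pi:\mathscr{H}\to X$. $(\mathscr{H},\mathscr{C})$ is a continuous field of Hilbert spaces if $\mathscr{C}\subset\Gamma(\mathscr{H})$ is a linear subspace such that: (a) $x\mapsto\|f(x)\|$ is continuous for all $f\in\mathscr{C}$; (b) every $g\in\Gamma(\mathscr{H})$ such that for all $x\in X,\varepsilon>0$ there are $f\in\mathscr{C}$ and a neighborhood $U$ of $x$ with $\|g(y)-f(y)\|\le\varepsilon$ for all $y\in U$ belongs to $\mathscr{C}$; (c) for all $x\in X,\zeta\in\mathscr{H}_x$ there is $f\in\mathscr{C}$ with $f(x)=\zeta$. $\mathscr{H}$ carries the topology with base $U(V,f,\varepsilon)=\{\zeta\in\mathscr{H}:\pi(\zeta)\in V,\ \|\zeta-f(\pi(\zeta))\|<\varepsilon\}$, $V\subset X$ open, $f\in\mathscr{C}$, $\varepsilon>0$; limits of nets in $\mathscr{H}$ refer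 to this topology. $\mathsf{S}(\mathscr{H})$ is the set of all self-adjoint (possibly unbounded) operators $T$ in $\mathscr{H}_x$ for some $x=:\pi(T)\in X$; $\varrho(T)$ is the resolvent set. For bounded operators $B_\alpha$ in $\mathscr{H}_{\pi(B_\alpha)}$, $\alpha\in A\cup\{\infty\}$, $B_\alpha\xrightarrow{\mathsf{ms}}B_\infty$ means: $\pi(B_\alpha)\to\pi(B_\infty)$ and for all $\zeta_\alpha\in\mathscr{H}_{\pi(B_\alpha)}$ $(\alpha\in A\cup\{\infty\})$, $\lim_\alpha\zeta_\alpha=\zeta_\infty$ in $\mathscr{H}$ implies $\lim_\alpha B_\alpha\zeta_\alpha=B_\infty\zeta_\infty$ in $\mathscr{H}$. $T_\alpha\xrightarrow{\mathsf{srs}}T_\infty$ (strong resolvent sense) means: there exists $\lambda\in\bigcap_\alpha\varrho(T_\alpha)\cap\varrho(T_\infty)$ with $(\lambda-T_\alpha)^{-1}\xrightarrow{\mathsf{ms}}(\lambda-T_\infty)^{-1}$. $T_\alpha\xrightarrow{G}T_\infty$ means: $\pi(T_\alpha)\to\pi(T_\infty)$ and for any $\zeta\in D(T_\infty)$ there exist $\zeta_\alpha\in D(T_\alpha)$ with $\lim\zeta_\alpha=\zeta$ and $\lim T_\alpha\zeta_\alpha=T_\infty\zeta$. *)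

(* Defs.v *)
From HB Require Import structures.
From mathcomp Require Import all_boot all_order all_algebra.
From mathcomp Require Import sesquilinear complex lra.
From mathcomp Require Import all_classical all_reals all_analysis.

Set Implicit Arguments.
Unset Strict Implicit.
Unset Printing Implicit Defensive.

Import Order.TTheory GRing.Theory Num.Theory Num.Def.
Import numFieldNormedType.Exports.

Local Open Scope classical_set_scope.
Local Open Scope ring_scope.

(** Complex Hilbert spaces; the inner product is linear in its first argument. *)
HB.mixin Record isHilbert (R : realType) H of CompleteNormedModule R[i] H := {
  inner : {dot H for (@conjC R[i])};
  sqr_normE : forall x : H, `|x| ^+ 2 = inner x x
}.

#[short(type="hilbertType")]
HB.structure Definition Hilbert (R : realType) :=
  { H of isHilbert R H & CompleteNormedModule R[i] H }.

(** The library norm takes its (real) values in [R[i]]; this is the same norm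
    with values in [R]. *)
Definition hnorm (R : realType) (H : hilbertType R) (x : H) : R :=
  complex.Re `|x|.

Lemma hnormE (R : realType) (H : hilbertType R) (x : H) :
  `|x| = real_complex R (hnorm x).
Proof. by rewrite /hnorm RRe_real // normr_real. Qed.

Lemma hnorm0 (R : realType) (H : hilbertType R) : hnorm (0 : H) = 0.
Proof. by rewrite /hnorm normr0. Qed.

Lemma ler_hnormD (R : realType) (H : hilbertType R) (x y : H) :
  hnorm (x + y) <= hnorm x + hnorm y.
Proof. by rewrite -lecR rmorphD /= -!hnormE ler_normD. Qed.

Record continuous_field (R : realType) (X : topologicalType) := ContinuousField {
  fiber :> X -> hilbertType R;
  csec : set (forall x, fiber x);
  csec0 : csec (fun x => 0);
  csec_linear : forall (a : R[i]) f g,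
    csec f -> csec g -> csec (fun x => a *: f x + g x);
  csec_norm_continuous : forall f, csec f ->
    continuous (fun x => hnorm (f x) : R);
  csec_local : forall g : (forall x, fiber x),
    (forall (x : X) (e : R), 0 < e ->
       exists2 f, csec f & \forall y \near x, hnorm (g y - f y) <= e) ->
    csec g;
  csec_full : forall x (z : fiber x), exists2 f, csec f & f x = z
}.

(** The disjoint union of the fibers.  A dedicated type is used instead of
    [{x & F x}], which the library equips with the disjoint union topology. *)
Record total_space (R : realType) (X : topologicalType)
    (F : continuous_field R X) := Total { tpi : X; tvec : F tpi }.
Arguments Total {R X F tpi} tvec.

Section total_space_topology.
Context (R : realType) (X : topologicalType) (F : continuous_field R X).

HB.instance Definition _ := gen_eqMixin (total_space F).
HB.instance Definition _ := gen_choiceMixin (total_space F).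

Definition tube (i : set X * (forall x, F x) * R) : set (total_space F) :=
  [set z | i.1.1 (tpi z) /\ hnorm (tvec z - i.1.2 (tpi z)) < i.2].

Definition tube_index : set (set X * (forall x, F x) * R) :=
  [set i | [/\ open i.1.1, csec i.1.2 & 0 < i.2]].

Lemma tube_cover : \bigcup_(i in tube_index) tube i = setT.
Proof.
rewrite -subTset => -[x z] _; have [f Cf fx] := csec_full z.
exists (setT, f, 1); first by split => //=; exact: openT.
by split=> //=; rewrite fx subrr hnorm0.
Qed.

Lemma tube_join i j t : tube_index i -> tube_index j -> tube i t -> tube j t ->
  exists k, [/\ tube_index k, tube k t & tube k `<=` tube i `&` tube j].
Proof.
have near_tube V f e (z : total_space F) (g : forall x, F x) :
    open V -> csec f -> csec g -> g (tpi z) = tvec z -> V (tpi z) ->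
    hnorm (tvec z - f (tpi z)) < e -> exists2 d, 0 < d &
    \forall y \near tpi z, V y /\ hnorm (g y - f y) < e - d.
  move=> oV Cf Cg gz Vz ze.
  pose d := (e - hnorm (tvec z - f (tpi z))) / 2.
  have d0 : 0 < d by rewrite divr_gt0 // subr_gt0.
  have Cgf : csec (fun x => -1 *: f x + g x) by exact: csec_linear.
  have gfE x : hnorm (g x - f x) = hnorm (-1 *: f x + g x).
    by rewrite scaleN1r addrC.
  have lt : hnorm (-1 *: f (tpi z) + g (tpi z)) < e - d.
    by rewrite -gfE gz /d; lra.
  have near_lt : \forall y \near tpi z, hnorm (-1 *: f y + g y) < e - d.
    exact: (csec_norm_continuous Cgf (lt_nbhsl lt)).
  exists d => //; near=> y; split.
    by near: y; exact: open_nbhs_nbhs.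
  by rewrite gfE; near: y.
case: i => [[V1 f1] e1]; case: j => [[V2 f2] e2].
move=> [/= oV1 Cf1 e10] [/= oV2 Cf2 e20] [/= V1t t1] [/= V2t t2].
have [g Cg gt] := csec_full (tvec t).
have [d1 d10 n1] := near_tube _ _ _ _ _ oV1 Cf1 Cg gt V1t t1.
have [d2 d20 n2] := near_tube _ _ _ _ _ oV2 Cf2 Cg gt V2t t2.
have := filterI n1 n2; set P := (P in nbhs _ P) => nP.
pose W := P°; have Wt : nbhs (tpi t) W by apply: nbhs_interior; exact: nP.
exists (W, g, Num.min d1 d2); split.
- by split => //=; [exact: open_interior | rewrite lt_min d10].
- split => /=; first exact: nbhs_singleton Wt.
  by rewrite gt subrr hnorm0 lt_min d10.
move=> [y w] [/= /interior_subset[[V1y y1] [V2y y2]]]; rewrite lt_min => /andP[w1 w2].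
have tri (f : forall x, F x) d e : hnorm (w - g y) < d ->
    hnorm (g y - f y) < e - d -> hnorm (w - f y) < e.
  move=> wd fd; have -> : w - f y = (w - g y) + (g y - f y).
    by rewrite addrA subrK.
  rewrite (le_lt_trans (ler_hnormD _ _)) // -[ltRHS](subrK d) addrC.
  exact: ltrD.
by split; split => //=; [exact: tri y1 | exact: tri y2].
Unshelve. all: by end_near. Qed.

HB.instance Definition _ :=
  isBaseTopological.Build (total_space F) tube_cover tube_join.

End total_space_topology.

(** The map [uop] is total; its values outside the domain [udom] are junk and
    are never used. *)
Record unbounded_operator (R : realType) (H : hilbertType R) :=
  UnboundedOperator {
    udom : set H;
    uop :> H -> H;
    udom0 : udom 0;
    udom_linear : forall (a : R[i]) x y,
      udom x -> udom y -> udom (a *: x + y);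
    uop_linear : forall (a : R[i]) x y,
      udom x -> udom y -> uop (a *: x + y) = a *: uop x + uop y
  }.

Definition op_graph (R : realType) (H : hilbertType R)
    (T : unbounded_operator H) : set (H * H) :=
  [set p | udom T p.1 /\ T p.1 = p.2].

(** The graph of the adjoint: a function graph when [udom T] is dense. *)
Definition adjoint_graph (R : realType) (H : hilbertType R)
    (T : unbounded_operator H) : set (H * H) :=
  [set p | forall x, udom T x -> inner (T x) p.1 = inner x p.2].

Definition self_adjoint (R : realType) (H : hilbertType R)
    (T : unbounded_operator H) : Prop :=
  dense (udom T) /\ op_graph T = adjoint_graph T.

(** [(lam - T)^-1]; meaningful when [lam - T] is a bijection from [udom T]
    onto [H]. *)
Definition resolvent (R : realType) (H : hilbertType R)
    (T : unbounded_operator H) (lam : R[i]) : H -> H :=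
  'pinv_(fun=> 0) (udom T) (fun x => lam *: x - T x).

Definition resolvent_set (R : realType) (H : hilbertType R)
    (T : unbounded_operator H) : set R[i] :=
  [set lam | set_bij (udom T) setT (fun x => lam *: x - T x) /\
     exists M : R, forall y, hnorm (resolvent T lam y) <= M * hnorm y].

Record sa_operator (R : realType) (X : topologicalType)
    (F : continuous_field R X) := SaOperator {
  spi : X;
  sop :> unbounded_operator (F spi);
  sop_self_adjoint : self_adjoint sop
}.

Definition directed (A : Type) (leA : A -> A -> Prop) : Prop :=
  [/\ inhabited A, (forall a, leA a a),
      (forall a b c, leA a b -> leA b c -> leA a c) &
      (forall a b, exists2 c, leA a c & leA b c)].

(** The filter of eventual properties: a net [u] on [A] converges to [l]
    when [u @ net_filter leA --> l]. *)
Definition net_filter (A : Type) (leA : A -> A -> Prop) : set_system A :=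
  filter_from setT (fun a => [set b | leA a b]).

Lemma net_filter_proper (A : Type) (leA : A -> A -> Prop) :
  directed leA -> ProperFilter (net_filter leA).
Proof.
move=> [[a0] leAxx leA_trans leA_dir].
apply: filter_from_proper => [|a _]; last by exists a; exact: leAxx.
apply: filter_from_filter => [|a b _ _]; first by exists a0.
have [c ac bc] := leA_dir a b; exists c => // d cd; split.
- exact: leA_trans ac cd.
- exact: leA_trans bc cd.
Qed.

(** The maps [B a] and [Boo] stand for bounded operators; below they are
    resolvents at points of the resolvent set. *)
Definition ms_cvg (R : realType) (X : topologicalType)
    (F : continuous_field R X) (A : Type) (leA : A -> A -> Prop)
    (x : A -> X) (B : forall a, F (x a) -> F (x a))
    (xoo : X) (Boo : F xoo -> F xoo) : Prop :=
  (x @ net_filter leA --> xoo) /\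
  forall (z : forall a, F (x a)) (zoo : F xoo),
    ((fun a => Total (z a)) @ net_filter leA --> Total zoo) ->
    ((fun a => Total (B a (z a))) @ net_filter leA --> Total (Boo zoo)).

Definition srs_cvg (R : realType) (X : topologicalType)
    (F : continuous_field R X) (A : Type) (leA : A -> A -> Prop)
    (T : A -> sa_operator F) (Too : sa_operator F) : Prop :=
  exists lam : R[i],
    [/\ (forall a, resolvent_set (T a) lam), resolvent_set Too lam &
        ms_cvg leA (fun a => resolvent (T a) lam) (resolvent Too lam)].

Definition G_cvg (R : realType) (X : topologicalType)
    (F : continuous_field R X) (A : Type) (leA : A -> A -> Prop)
    (T : A -> sa_operator F) (Too : sa_operator F) : Prop :=
  ((fun a => spi (T a)) @ net_filter leA --> spi Too) /\
  forall z : F (spi Too), udom Too z ->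
    exists za : forall a, F (spi (T a)),
      [/\ (forall a, udom (T a) (za a)),
          ((fun a => Total (za a)) @ net_filter leA --> Total z) &
          ((fun a => Total (T a (za a))) @ net_filter leA --> Total (Too z))].

(* Main.v *)
(** If the resolvents at [lam] converge, every [z] in the domain of [Too] is the
    limit of [z_a := (lam - T_a)^-1 w_a] for any [w_a] tending to
    [(lam - Too) z], and then [T_a z_a = lam z_a - w_a] tends to [Too z].
    Conversely one takes [lam := 'i], which lies in every resolvent set.  Given
    [z_a] tending to [z], graph convergence approximates [y := ('i - Too)^-1 z]
    by [y_a] with [('i - T_a) y_a] tending to [z]; since ['i - T_a] does not
    decrease norms, [('i - T_a)^-1 z_a - y_a] tends to [0]. *)

Require Import Defs.
From mathcomp Require Import all_boot all_order all_algebra.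
From mathcomp Require Import sesquilinear complex lra ring.
From mathcomp Require Import all_classical all_reals all_analysis.

Set Implicit Arguments.
Unset Strict Implicit.
Unset Printing Implicit Defensive.

Import Order.TTheory GRing.Theory Num.Theory Num.Def.
Import numFieldNormedType.Exports.

Local Open Scope classical_set_scope.
Local Open Scope ring_scope.
Local Open Scope complex_scope.

(** * Geometry of one Hilbert space: Cauchy-Schwarz, completeness, orthogonal projection *)

Section hilbert.
Context (R : realType) (H : hilbertType R).
Implicit Types (x y l : H) (u : nat -> H) (a : R[i]).

Lemma hnorm_ge0 x : 0 <= hnorm x.
Proof. by rewrite -lecR -hnormE normr_ge0. Qed.

Lemma hnormN x : hnorm (- x) = hnorm x.
Proof. by rewrite /hnorm normrN. Qed.

Lemma hnormB x y : hnorm (x - y) = hnorm (y - x).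
Proof. by rewrite -hnormN opprB. Qed.

Lemma hnorm_eq0 x : hnorm x = 0 -> x = 0.
Proof. by move=> x0; apply/normr0_eq0; rewrite hnormE x0. Qed.

Lemma hnormZ a x : hnorm (a *: x) = complex.Re `|a| * hnorm x.
Proof.
by by apply: (@complexI R); rewrite rmorphM /= -!hnormE normrZ.
Qed.

Lemma inner_hnorm x : inner x x = (hnorm x ^+ 2)%:C.
Proof. by rewrite -sqr_normE hnormE rmorphXn. Qed.

Lemma innerC x y : inner x y = conjC (inner y x).
Proof. by rewrite (hermC (@inner R H)) /= expr0 mul1r. Qed.

Lemma innerZr a x y : inner x (a *: y) = conjC a * inner x y.
Proof. exact: linearZr_LR. Qed.

Lemma innerZl a x y : inner (a *: x) y = a * inner x y.
Proof. exact: linearZl_LR. Qed.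

Lemma Re_normE a : (complex.Re `|a|)%:C = `|a|.
Proof. exact/RRe_real/normr_real. Qed.

Lemma Re_norm_ge0 a : 0 <= complex.Re `|a|.
Proof. by rewrite -lecR Re_normE normr_ge0. Qed.

Lemma innerBr x y l : inner x (y - l) = inner x y - inner x l.
Proof. exact: linearBr. Qed.

(** For real [t] both cross terms equal [t * k]. Two choices of [t] are used later: one gives
    Cauchy-Schwarz, the other the orthogonality of a minimizer. *)
Lemma sqr_hnormB_inner (t : R) x y (k := complex.Re `|inner x y| ^+ 2) :
  hnorm (x - (t%:C * inner x y) *: y) ^+ 2 =
  hnorm x ^+ 2 - (t * k) *+ 2 + t ^+ 2 * k * hnorm y ^+ 2.
Proof.
have kE : k%:C = inner x y * conjC (inner x y).
  by rewrite -normCK rmorphXn; congr (_ ^+ 2); exact: Re_normE.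
have tE : conjC t%:C = t%:C by exact: conjc_real.
apply: (@complexI R).
move: k kE => k kE; rewrite !(rmorphD, rmorphB, rmorphMn, rmorphM) /= kE.
have hE (z : H) : (hnorm z)%:C * (hnorm z)%:C = inner z z.
  by rewrite inner_hnorm expr2 rmorphM.
rewrite mulr2n !hE dnormB dnormZ innerZr normCK.
rewrite !rmorphM /= !conjCK !tE rmorphN rmorphD /= !rmorphM /= kE; ring.
Qed.

Lemma parallelogram x y :
  hnorm (x + y) ^+ 2 + hnorm (x - y) ^+ 2 = (hnorm x ^+ 2 + hnorm y ^+ 2) *+ 2.
Proof.
apply: (@complexI R); rewrite rmorphD rmorphMn rmorphD /= -!inner_hnorm.
by rewrite dnormB dnormD addrACA subrr addr0 mulr2n.
Qed.

Lemma cauchy_schwarz x y :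
  complex.Re `|inner x y| <= hnorm x * hnorm y.
Proof.
have [->|y0] := eqVneq y 0.
  by rewrite linear0r normr0 hnorm0 mulr0.
have ny : 0 < hnorm y ^+ 2.
  rewrite exprn_gt0 // lt_neqAle hnorm_ge0 andbT eq_sym.
  by apply: contra_neq y0; exact: hnorm_eq0.
(* With [t = hnorm y ^- 2] the vector is the component of [x] orthogonal to [y]. *)
have := sqr_ge0 (hnorm (x - ((hnorm y ^- 2)%:C * inner x y) *: y)).
rewrite sqr_hnormB_inner; set k := complex.Re `|inner x y| ^+ 2.
set N := hnorm y ^+ 2 in ny *.
have -> : N^-1 ^+ 2 * k * N = N^-1 * k by field; rewrite gt_eqF.
rewrite mulr2n opprD addrA subrK subr_ge0 mulrC ler_pdivrMr // -exprMn.
by rewrite ler_pXn2r // nnegrE ?mulr_ge0 ?hnorm_ge0 // Re_norm_ge0.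
Qed.

(** Library balls have radii in [R[i]], but a positive element of [R[i]] is real, so real radii
    suffice. *)
Lemma hnorm_cvgP u l :
  u @ \oo --> l <->
  forall e : R, 0 < e -> \forall n \near \oo, hnorm (l - u n) < e.
Proof.
split=> [/cvgrPdist_lt ul e e0|ul].
  have e0' : 0 < e%:C by rewrite ltcR.
  by apply: filterS (ul _ e0') => n; rewrite hnormE ltcR.
apply/cvgrPdist_lt => e e0.
have eE : e = (complex.Re e)%:C by rewrite RRe_real // gtr0_real.
rewrite eE ltcR in e0 *.
by apply: filterS (ul _ e0) => n; rewrite hnormE ltcR.
Qed.

Lemma hnorm_cauchy_cvg u :
  (forall e : R, 0 < e ->
    exists N, forall n k, (N <= n)%N -> (N <= k)%N -> hnorm (u n - u k) < e) ->
  exists l, u @ \oo --> l.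
Proof.
move=> uC; suff /cauchy_cvgP/cvg_ex[l ul] : cauchy (u @ \oo) by exists l.
apply: cauchy_exP => e e0.
have eE : e = (complex.Re e)%:C by rewrite RRe_real // gtr0_real.
rewrite eE ltcR in e0 *.
have [N uN] := uC _ e0; exists (u N); exists N => // n /= Nn.
by rewrite -ball_normE /ball_ /= hnormE ltcR; exact: uN.
Qed.


(* A minimizing sequence for the distance to [y] is Cauchy by the parallelogram
   law. *)
Lemma orthogonal_projection (M : set H) y :
  M 0 ->
  (forall a x z, M x -> M z -> M (a *: x + z)) ->
  (forall u l, (forall n, M (u n)) -> u @ \oo --> l -> M l) ->
  exists2 m, M m & forall x, M x -> inner (y - m) x = 0.
Proof.
move=> M0 Ml Mc.
pose E := [set hnorm (y - m) ^+ 2 | m in M].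
have E_inf : has_inf E.
  split; first by exists (hnorm (y - 0) ^+ 2), 0.
  by exists 0 => _ [m _ <-]; exact: sqr_ge0.
pose d := inf E.
have d_le m : M m -> d <= hnorm (y - m) ^+ 2.
  by move=> Mm; apply: ge_inf; [exact: (proj2 E_inf)|exists m].
have /choice[u uP] : forall n : nat, exists m,
    M m /\ hnorm (y - m) ^+ 2 < d + n.+1%:R^-1.
  move=> n; have n0 : 0 < n.+1%:R^-1 :> R by rewrite invr_gt0.
  by have [_ [m Mm <-] lt] := inf_adherent n0 E_inf; exists m.
have u_dist n k : hnorm (u n - u k) ^+ 2 <= (n.+1%:R^-1 + k.+1%:R^-1) *+ 2.
  have [Mn ltn] := uP n; have [Mk ltk] := uP k.
  have := parallelogram (y - u n) (y - u k).
  have -> : y - u n - (y - u k) = u k - u n.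
    by rewrite opprB addrC addrA subrK.
  rewrite (hnormB (u k)).
  (* The midpoint of [u n] and [u k] lies in [M], so its squared distance to [y] is at least [d]. In
     the parallelogram law this bounds the squared norm of the sum below by [4 * d]. *)
  have Mhalf : M (2^-1 *: (u n + u k)).
    rewrite -[_ *: _]addr0; apply: (Ml) => //.
    by rewrite -[u n]scale1r; exact: Ml.
  have -> : y - u n + (y - u k) = 2 *: (y - 2^-1 *: (u n + u k)).
    rewrite scalerBr scalerA divff ?pnatr_eq0 // scale1r scaler_nat mulr2n.
    by rewrite addrACA opprD.
  rewrite hnormZ ger0_norm // exprMn.
  have := d_le _ Mhalf.
  set D := hnorm (y - _ *: _) ^+ 2.
  have -> : complex.Re (2 : R[i]) = 2%:R by [].
  rewrite -natrX.
  move: ltn ltk D (hnorm (u n - u k) ^+ 2).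
  move: (n.+1%:R^-1) (k.+1%:R^-1) (hnorm (y - u n) ^+ 2) (hnorm (y - u k) ^+ 2).
  clear; move: d => d p q v w + + D z; lra.
have [l ul] : exists l, u @ \oo --> l.
  apply: hnorm_cauchy_cvg => e e0.
  (* Two reciprocals below [e ^+ 2 / 4], doubled as in [u_dist], add up to less than [e ^+ 2]. *)
  have e2 : 0 < e ^+ 2 / 4 by rewrite divr_gt0 ?exprn_gt0.
  have [N _ NP] := near_infty_natSinv_lt (PosNum e2).
  exists N => n k Nn Nk; rewrite -(@ltr_pXn2r _ 2) ?nnegrE ?hnorm_ge0 ?ltW //.
  apply: le_lt_trans (u_dist n k) _.
  have := NP n Nn; have := NP k Nk => /=.
  move: (n.+1%:R^-1) (k.+1%:R^-1) (e ^+ 2) => p q E2 pE qE; lra.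
exists l; first by apply: Mc ul => n; have [] := uP n.
have dl : hnorm (y - l) ^+ 2 <= d.
  rewrite leNgt; apply/negP => ltd; pose b := hnorm (y - l).
  have b0 : 0 <= b by exact: hnorm_ge0.
  pose e := b ^+ 2 - d; have e0 : 0 < e by rewrite subr_gt0.
  have e2 : 0 < e / 2 by rewrite divr_gt0.
  (* For [s := hnorm (l - u n)] below 1 and [w := hnorm (y - u n)], the bounds [b <= w + s] and
     [w <= b + s] give [b ^+ 2 <= w ^+ 2 + (2 * b + 3) * s]. One half of [e] absorbs the last term,
     the other half the excess of [w ^+ 2] over [d]. *)
  have b3 : 0 < 2 * b + 3 by rewrite ltr_wpDl ?mulr_ge0.
  have s0 : 0 < Num.min 1 (e / 2 / (2 * b + 3)).
    by rewrite lt_min ltr01 divr_gt0.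
  have un := (proj1 (hnorm_cvgP _ _) ul) _ s0.
  have dn := near_infty_natSinv_lt (PosNum e2).
  have [n [/= + den]] := filter_ex (filterI un dn).
  rewrite lt_min => /andP[s1]; set s := hnorm _ in s1 *.
  rewrite ltr_pdivlMr // => sb.
  have [_ dun] := uP n; have := ler_hnormD (y - u n) (u n - l).
  rewrite addrA subrK (hnormB (u n)) -/s -/b.
  have := hnorm_ge0 (l - u n); rewrite -/s.
  move: dun den; set w := hnorm (y - u n); set q := n.+1%:R^-1.
  have : w <= b + s.
    by have := ler_hnormD (y - l) (l - u n); rewrite addrA subrK.
  have : 0 <= w by exact: hnorm_ge0.
  move=> w0 wb dun dq s_ge0 bw.
  have h1 : b ^+ 2 <= (w + s) ^+ 2 by rewrite ler_pXn2r // nnegrE addr_ge0.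
  have h2 : w * s <= (b + s) * s by rewrite ler_wpM2r.
  have h3 : s * s <= s by rewrite ler_piMl // ltW.
  move: h1 dun h2 h3 dq s1 sb; rewrite /e sqrrD !mulrDl mulr2n.
  have -> : s * (1 * b + 1 * b + 3) = b * s + b * s + s + s + s by ring.
  rewrite [s ^+ 2]expr2.
  move: (b ^+ 2) (w ^+ 2) (w * s) (b * s) (s * s).
  clear; move: d q s => d q s b2 w2 ws bs s2; lra.
move=> x Mx.
set r := y - l.
(* This [t] is positive even if [x = 0], and [t * hnorm x ^+ 2 = 1 - t]. Moving [l] along [x] then
   changes the squared distance by [- (t * (1 + t) * k)], which minimality forbids to be
   negative. *)
pose t := (1 + hnorm x ^+ 2)^-1.
have := sqr_hnormB_inner t r x.
have : d <= hnorm (r - (t%:C * inner r x) *: x) ^+ 2.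
  have -> : r - (t%:C * inner r x) *: x = y - ((t%:C * inner r x) *: x + l).
    by rewrite opprD addrCA addrC.
  by apply: d_le; apply: Ml => //; apply: Mc ul => n; have [] := uP n.
have := dl; rewrite -/r.
set k := complex.Re `|inner r x| ^+ 2 => dl1 dl2 E1.
have : k <= 0.
  have k0 : 0 <= k by exact: sqr_ge0.
  have xt : t * (1 + hnorm x ^+ 2) = 1.
    by rewrite mulVf // gt_eqF // ltr_pwDl ?sqr_ge0.
  have t0 : 0 < t by rewrite invr_gt0 ltr_pwDl ?sqr_ge0.
  have := le_trans dl1 dl2; rewrite E1 -addrA lerDl addrC mulr2n.
  have -> : t ^+ 2 * k * hnorm x ^+ 2 = (t * k) * (t * hnorm x ^+ 2) by ring.
  have -> : t * hnorm x ^+ 2 = 1 - t.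
    by rewrite -xt mulrDr mulr1 addrAC subrr add0r.
  have -> : t * k * (1 - t) - (t * k + t * k) = - (t * (1 + t) * k) by ring.
  by rewrite oppr_ge0 pmulr_rle0 // mulr_gt0 // addr_gt0.
have k0 : 0 <= k by exact: sqr_ge0.
move=> k1; have : k == 0 by rewrite eq_le k1.
rewrite sqrf_eq0 => /eqP h.
by apply/normr0_eq0; rewrite -Re_normE h.
Qed.
End hilbert.

(** * Self-adjoint operators: closed graph and the resolvent at ['i] *)

Section unbounded_operators.
Context (R : realType) (H : hilbertType R) (T : unbounded_operator H).
Implicit Types (x y v : H) (u : nat -> H).

Lemma uopB x y : udom T x -> udom T y -> T (x - y) = T x - T y.
Proof.
by move=> Dx Dy; rewrite addrC -scaleN1r uop_linear // scaleN1r addrC.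
Qed.

Lemma udomB x y : udom T x -> udom T y -> udom T (x - y).
Proof. by move=> Dx Dy; rewrite addrC -scaleN1r; exact: udom_linear. Qed.

Lemma uop0 : T 0 = 0.
Proof. by rewrite -(subrr 0) uopB ?subrr //; exact: udom0. Qed.

Lemma lam_subop_linear lam a x y : udom T x -> udom T y ->
  lam *: (a *: x + y) - T (a *: x + y) =
  a *: (lam *: x - T x) + (lam *: y - T y).
Proof.
move=> Dx Dy; rewrite uop_linear // scalerDr scalerBr !scalerA (mulrC a).
by rewrite opprD addrACA.
Qed.

Lemma lam_subopB lam x y : udom T x -> udom T y ->
  lam *: (x - y) - T (x - y) = (lam *: x - T x) - (lam *: y - T y).
Proof.
move=> Dx Dy; have -> : x - y = -1 *: y + x by rewrite scaleN1r addrC.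
by rewrite lam_subop_linear // scaleN1r addrC.
Qed.

Lemma resolventP lam y : set_bij (udom T) setT (fun x => lam *: x - T x) ->
  udom T (resolvent T lam y) /\
  lam *: resolvent T lam y - T (resolvent T lam y) = y.
Proof.
move=> [_ _ surj]; split; first by apply: (surjpinv_image_sub surj); exists y.
by rewrite /resolvent (surjpK _ surj) // inE.
Qed.

Lemma resolventK lam x : set_bij (udom T) setT (fun x => lam *: x - T x) ->
  udom T x -> resolvent T lam (lam *: x - T x) = x.
Proof.
move=> bij Dx; have [Dr rE] := resolventP (lam *: x - T x) bij.
by have [_ inj _] := bij; apply: inj; rewrite ?inE.
Qed.

Hypothesis saT : self_adjoint T.

Lemma self_adjoint_sym x y :
  udom T x -> udom T y -> inner (T x) y = inner x (T y).
Proof.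
move=> Dx Dy; have [_ gT] := saT.
have : op_graph T (y, T y) by [].
by rewrite gT; apply.
Qed.

Lemma self_adjointP y v :
  (forall x, udom T x -> inner (T x) y = inner x v) -> udom T y /\ T y = v.
Proof.
move=> yv; have [_ gT] := saT.
suff : op_graph T (y, v) by [].
by rewrite gT.
Qed.

(** The graph of [T] is that of its adjoint, which is cut out by equations continuous in the pair;
    by symmetry the pairs [(u n, T (u n))] satisfy them, hence so does the limit. *)
Lemma self_adjoint_closed u x v :
  (forall n, udom T (u n)) -> u @ \oo --> x -> (T \o u) @ \oo --> v ->
  udom T x /\ T x = v.
Proof.
move=> Du ux uv; apply: self_adjointP => w Dw.
apply/eqP; rewrite -subr_eq0 -normr_eq0 -Re_normE.
set c := complex.Re _.
have c0 : 0 <= c by exact: Re_norm_ge0.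
suff -> : c = 0 by [].
apply/eqP; rewrite eq_le c0 andbT; apply/ler_addgt0Pr => e e0; rewrite add0r.
(* Cauchy-Schwarz will bound [c] by [(hnorm (T w) + hnorm w) * (e / m)]; the summand 1 keeps [m]
   positive. *)
pose m := 1 + hnorm (T w) + hnorm w.
have m0 : 0 < m by rewrite /m -addrA ltr_pwDl ?addr_ge0 ?hnorm_ge0.
have em : 0 < e / m by rewrite divr_gt0.
have [n [un Tn]] := filter_ex (filterI ((proj1 (hnorm_cvgP _ _) ux) _ em)
  ((proj1 (hnorm_cvgP _ _) uv) _ em)).
have cE : inner (T w) x - inner w v =
    inner (T w) (x - u n) - inner w (v - T (u n)).
  by rewrite !innerBr (self_adjoint_sym Dw (Du n)) opprB addrA subrK.
have cle : c <= hnorm (T w) * hnorm (x - u n) +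
    hnorm w * hnorm (v - T (u n)).
  apply: le_trans (lerD (cauchy_schwarz _ _) (cauchy_schwarz _ _)).
  by rewrite /c cE -lecR rmorphD !Re_normE ler_normB.
apply: le_trans cle _.
have -> : e = (1 + hnorm (T w) + hnorm w) * (e / m).
  by rewrite -/m mulrC divfK // gt_eqF.
rewrite -addrA mulrDl mul1r ler_wpDl ?(ltW em) //.
by rewrite mulrDl lerD // ler_wpM2l ?hnorm_ge0 // ltW.
Qed.

(** By symmetry [inner x (T x)] is real, so the cross term ['i * inner x (T x)] is purely imaginary
    and cancels against its conjugate. *)
Lemma self_adjoint_hnorm x : udom T x ->
  hnorm ('i%R *: x - T x) ^+ 2 = hnorm x ^+ 2 + hnorm (T x) ^+ 2.
Proof.
move=> Dx; apply: (@complexI R); rewrite rmorphD /= -!inner_hnorm.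
rewrite dnormB dnormZ normCi expr1n mul1r innerZl rmorphM /= conjCi -innerC.
by rewrite self_adjoint_sym // mulNr subrr subr0.
Qed.

(** This lower bound yields injectivity of ['i - T], closedness of its range, the bound 1 for the
    resolvent, and finally the convergence of the resolvents. *)
Lemma self_adjoint_hnorm_le x : udom T x -> hnorm x <= hnorm ('i%R *: x - T x).
Proof.
move=> Dx; rewrite -(@ler_pXn2r _ 2) ?nnegrE ?hnorm_ge0 //.
by rewrite self_adjoint_hnorm // lerDl sqr_ge0.
Qed.

(* A vector [r] orthogonal to the range of ['i - T] lies in the domain of the
   adjoint, hence satisfies [T r = - 'i *: r], which forces [r = 0]. *)
Lemma self_adjoint_surj y : exists2 x, udom T x & 'i%R *: x - T x = y.
Proof.
pose M := [set 'i%R *: x - T x | x in udom T].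
have [||u l Mu ul|m [x Dx xm] mP] := @orthogonal_projection _ _ M y.
- by exists 0; [exact: udom0 | rewrite uop0 scaler0 subr0].
- move=> a _ _ [x Dx <-] [z Dz <-]; exists (a *: x + z); first exact: udom_linear.
  exact: lam_subop_linear.
(* The range is closed: preimages [w n] of [u n] are Cauchy by the lower bound, so
   [T (w n) = 'i *: w n - u n] converges as well and the closed graph applies. *)
- have /choice[w wP] : forall n, exists x, udom T x /\ 'i%R *: x - T x = u n.
    by move=> n; have [x Dx xE] := Mu n; exists x.
  have [x wx] : exists x, w @ \oo --> x.
    apply: hnorm_cauchy_cvg => e e0.
    have e2 : 0 < e / 2 by rewrite divr_gt0.
    have [N _ NP] := (proj1 (hnorm_cvgP _ _) ul) _ e2.
    exists N => n k Nn Nk; have [Dn En] := wP n; have [Dk Ek] := wP k.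
    apply: le_lt_trans (self_adjoint_hnorm_le (udomB Dn Dk)) _.
    rewrite lam_subopB // En Ek -(subrK l (u n)) -addrA.
    apply: le_lt_trans (ler_hnormD _ _) _.
    by rewrite hnormB (splitr e) ltrD //; [exact: NP Nn | exact: NP Nk].
  have Tw : (T \o w) @ \oo --> 'i%R *: x - l.
    have -> : T \o w = fun n => 'i%R *: w n - u n.
      by apply/funext => n /=; have [_ <-] := wP n; rewrite subKr.
    by apply: cvgB => //; exact: cvgZl_tmp.
  have [|Dx Tx] := self_adjoint_closed _ wx Tw; first by move=> n; have [] := wP n.
  by exists x => //; rewrite Tx subKr.
have [Dr Tr] : udom T (y - m) /\ T (y - m) = - 'i%R *: (y - m).
  apply: self_adjointP => z Dz.
  have /mP h : M ('i%R *: z - T z) by exists z.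
  move/eqP: h; rewrite [X in X == 0]innerBr subr_eq0 innerZr conjCi => /eqP h.
  by rewrite innerC -h rmorphM /= innerZr -innerC.
suff r0 : y - m = 0.
  by exists x => //; rewrite xm; apply/eqP; rewrite eq_sym -subr_eq0 r0.
(* For [r := y - m] this element of the range is ['i *: r + 'i *: r], so [r] is orthogonal to a
   nonzero multiple of itself. *)
have /mP : M ('i%R *: (y - m) - T (y - m)) by exists (y - m).
rewrite Tr scaleNr opprK -scalerDl innerZr inner_hnorm => /eqP.
rewrite mulf_eq0 conjC_eq0 -mulr2n mulrn_eq0 /= (negPf (neq0Ci _)) /= => /eqP/complexI/eqP.
by rewrite sqrf_eq0 => /eqP; exact: hnorm_eq0.
Qed.

Lemma self_adjoint_resolvent_set : resolvent_set T 'i%R.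
Proof.
have bij : set_bij (udom T) setT (fun x => 'i%R *: x - T x).
  split=> //.
  - move=> x z; rewrite !inE => Dx Dz xz; apply/eqP; rewrite -subr_eq0.
    apply/eqP/hnorm_eq0/eqP; rewrite eq_le hnorm_ge0 andbT.
    apply: le_trans (self_adjoint_hnorm_le (udomB Dx Dz)) _.
    by rewrite lam_subopB // xz subrr hnorm0.
  - by move=> y _; have [x Dx <-] := self_adjoint_surj y; exists x.
split=> //; exists 1 => y; rewrite mul1r.
have [Dr {2}<-] := resolventP y bij.
exact: self_adjoint_hnorm_le.
Qed.
End unbounded_operators.

(** * Convergence in the total space along a filter *)

Section total_space_convergence.
Context (R : realType) (X : topologicalType) (F : continuous_field R X).

Lemma csecZB (a : R[i]) (f g : forall y, F y) :
  csec f -> csec g -> csec (fun y => a *: f y - g y).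
Proof.
move=> Cf Cg.
have -> : (fun y => a *: f y - g y) = fun y => -1 *: g y + (a *: f y + 0).
  by apply: functional_extensionality_dep => y; rewrite addr0 scaleN1r addrC.
by apply: csec_linear Cg _; apply: csec_linear Cf _; exact: csec0.
Qed.

Context (I : Type) (G : set_system I) {FG : Filter G}.
Implicit Types (x : I -> X).

(* Only one continuous section through the limit has to be tested. *)
Lemma cvg_TotalP x (z : forall i, F (x i)) (xoo : X) (zoo : F xoo)
    (f : forall y, F y) : csec f -> f xoo = zoo ->
  ((fun i => Total (z i)) @ G --> Total zoo) <->
  (x @ G --> xoo) /\
  (forall e : R, 0 < e -> \forall i \near G, hnorm (z i - f (x i)) < e).
Proof.
move=> Cf fxoo; have tubeP (V : set X) (g : forall y, F y) (e : R) :
    open V -> csec g -> 0 < e -> V xoo -> hnorm (zoo - g xoo) < e ->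
    nbhs (Total zoo) (tube (V, g, e)).
  move=> oV Cg e0 Vx zg; rewrite nbhsE /=.
  exists (tube (V, g, e)) => //; split=> //.
  by exists [set (V, g, e)]; [move=> _ -> | rewrite bigcup_set1].
split=> [zc|[xc zf] N].
  have zG V : nbhs (Total zoo) V -> \forall i \near G, V (Total (z i)).
    exact: zc.
  split=> [V|e e0].
    rewrite nbhsE => -[W [oW Wx] WV].
    (* The radius 1 is arbitrary: only the base point of the tube matters here. *)
    have /zG : nbhs (Total zoo) (tube (W, f, 1)).
      by apply: tubeP => //; rewrite fxoo subrr hnorm0.
    by rewrite nbhs_filterE /=; apply: filterS => i [/= /WV].
  have /zG : nbhs (Total zoo) (tube (setT, f, e)).
    by apply: tubeP => //; [exact: openT | rewrite fxoo subrr hnorm0].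
  by apply: filterS => i [].
rewrite nbhs_filterE nbhsE => -[W [[D Dt <-] [[[V g] e] Dk [/= Vx zg]]] WN].
have [/= oV Cg e0] := Dt _ Dk.
(* At [xoo] the norm of [f - g] is [e - 2 * d], so it stays below [e - d] nearby, which leaves [d]
   for [z i - f (x i)]. *)
pose d := (e - hnorm (zoo - g xoo)) / 2.
have d0 : 0 < d by rewrite divr_gt0 // subr_gt0.
have Cgf : csec (fun y => 1 *: f y - g y) by exact: csecZB.
have lt : hnorm (1 *: f xoo - g xoo) < e - d.
  by rewrite scale1r fxoo /d; move: zg; move: (hnorm _) => h zg; lra.
have near_lt : \forall y \near xoo, hnorm (1 *: f y - g y) < e - d.
  exact: (csec_norm_continuous Cgf (lt_nbhsl lt)).
have xV : \forall i \near G, V (x i) by apply: xc; exact: open_nbhs_nbhs.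
have xg : \forall i \near G, hnorm (1 *: f (x i) - g (x i)) < e - d.
  exact: (xc _ near_lt).
apply: filterS3 xV xg (zf _ d0) => i Vi gi fi; apply: WN; exists (V, g, e) => //.
split=> //=.
have -> : z i - g (x i) = (z i - f (x i)) + (1 *: f (x i) - g (x i)).
  by rewrite scale1r addrA subrK.
by rewrite (le_lt_trans (ler_hnormD _ _)) // -[ltRHS](subrK d) addrC ltrD.
Qed.

(** A continuous section through [zoo], evaluated along [x], provides the net. *)
Lemma ex_cvg_Total x (xoo : X) (zoo : F xoo) : x @ G --> xoo ->
  exists z : forall i, F (x i), (fun i => Total (z i)) @ G --> Total zoo.
Proof.
have [f Cf fz] := csec_full zoo => xc; exists (fun i => f (x i)).
apply/(cvg_TotalP _ Cf fz); split=> // e e0.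
by apply: nearW => i; rewrite subrr hnorm0.
Qed.

(** If [f] and [g] are sections through the two limits, [a *: f - g] is a section through the new
    one, and testing against it is enough. *)
Lemma cvg_TotalZB (a : R[i]) x (z w : forall i, F (x i)) (xoo : X)
    (zoo woo : F xoo) :
  ((fun i => Total (z i)) @ G --> Total zoo) ->
  ((fun i => Total (w i)) @ G --> Total woo) ->
  (fun i => Total (a *: z i - w i)) @ G --> Total (a *: zoo - woo).
Proof.
have [f Cf fz] := csec_full zoo; have [g Cg gw] := csec_full woo.
move=> /(cvg_TotalP _ Cf fz)[xc zf] /(cvg_TotalP _ Cg gw)[_ wg].
have Cfg : csec (fun y => a *: f y - g y) by exact: csecZB.
apply/(cvg_TotalP _ Cfg); first by rewrite fz gw.
(* Adding 1 makes division by [m] safe when [a = 0]. *)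
split=> // e e0; pose m := complex.Re `|a| + 1.
have a0 := Re_norm_ge0 a.
have m0 : 0 < m by rewrite ltr_wpDl.
have e2 : 0 < e / 2 by rewrite divr_gt0.
apply: filterS2 (zf _ (divr_gt0 e2 m0)) (wg _ e2) => i zi wi.
have -> : a *: z i - w i - (a *: f (x i) - g (x i)) =
    a *: (z i - f (x i)) - (w i - g (x i)).
  by rewrite scalerBr !opprB addrACA [RHS]addrACA (addrC (- w i)).
rewrite (le_lt_trans (ler_hnormD _ _)) // hnormN hnormZ.
rewrite (splitr e) ler_ltD //.
apply: le_trans (ler_wpM2l a0 (ltW zi)) _.
by rewrite mulrCA ler_piMr ?(ltW e2) // ler_pdivrMr // mul1r lerDl.
Qed.

(** Together with [cvg_Total_sub0] this turns convergence into norm estimates inside single fibers,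
    where the operators act. *)
Lemma cvg_Total_close x (z w : forall i, F (x i)) (xoo : X) (zoo : F xoo) :
  ((fun i => Total (z i)) @ G --> Total zoo) ->
  (forall e : R, 0 < e -> \forall i \near G, hnorm (w i - z i) < e) ->
  (fun i => Total (w i)) @ G --> Total zoo.
Proof.
have [f Cf fz] := csec_full zoo; move=> /(cvg_TotalP _ Cf fz)[xc zf] wz.
apply/(cvg_TotalP _ Cf fz); split=> // e e0.
have e2 : 0 < e / 2 by rewrite divr_gt0.
apply: filterS2 (zf _ e2) (wz _ e2) => i zi wi.
rewrite -(subrK (z i) (w i)) -addrA (le_lt_trans (ler_hnormD _ _)) //.
by rewrite (splitr e) ltrD.
Qed.

Lemma cvg_Total_sub0 x (z w : forall i, F (x i)) (xoo : X) (zoo : F xoo) :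
  ((fun i => Total (z i)) @ G --> Total zoo) ->
  ((fun i => Total (w i)) @ G --> Total zoo) ->
  forall e : R, 0 < e -> \forall i \near G, hnorm (w i - z i) < e.
Proof.
have [f Cf fz] := csec_full zoo.
move=> /(cvg_TotalP _ Cf fz)[_ zf] /(cvg_TotalP _ Cf fz)[_ wf] e e0.
have e2 : 0 < e / 2 by rewrite divr_gt0.
apply: filterS2 (zf _ e2) (wf _ e2) => i zi wi.
rewrite -(subrK (f (x i)) (w i)) -addrA (le_lt_trans (ler_hnormD _ _)) //.
by rewrite (hnormB (f (x i))) (splitr e) ltrD.
Qed.
End total_space_convergence.

(** * Strong resolvent convergence against graph convergence *)

Section resolvent_convergence.
Context (R : realType) (X : topologicalType) (F : continuous_field R X).
Context (A : Type) (leA : A -> A -> Prop) (dA : directed leA).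
Context (T : A -> sa_operator F) (Too : sa_operator F).

Lemma srs_cvg_G_cvg : srs_cvg leA T Too -> G_cvg leA T Too.
Proof.
have FA := net_filter_proper dA.
move=> [lam [rT [rToo _] [xc ms]]]; split=> // z Dz.
pose w := lam *: z - Too z.
have [wa wc] := ex_cvg_Total w xc.
have zc := ms _ _ wc; rewrite /w resolventK // in zc.
exists (fun a => resolvent (T a) lam (wa a)).
have raP a := resolventP (wa a) (proj1 (rT a)).
split=> [a||]; [by have [] := raP a | by [] | ].
have TE : (fun a => Total (lam *: resolvent (T a) lam (wa a) - wa a)) =
    (fun a => Total (T a (resolvent (T a) lam (wa a)))) :> (A -> total_space F).
  by apply/funext => a; have [_ {2}<-] := raP a; rewrite subKr.
rewrite -TE -[Too z](subKr (lam *: z)).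
exact: cvg_TotalZB zc wc.
Qed.

Lemma G_cvg_srs_cvg : G_cvg leA T Too -> srs_cvg leA T Too.
Proof.
have FA := net_filter_proper dA.
move=> [xc gc].
have rT S := self_adjoint_resolvent_set (@sop_self_adjoint _ _ F S).
exists 'i%R; split=> //; split=> // z zoo zc.
have [Dy yE] := resolventP zoo (proj1 (rT Too)).
set y := resolvent Too _ zoo in Dy yE *.
have [ya [Dya yc Tyc]] := gc _ Dy.
have wc :
    (fun a => Total ('i%R *: ya a - T a (ya a))) @ net_filter leA --> Total zoo.
  by rewrite -yE; exact: cvg_TotalZB yc Tyc.
(* [hnorm x <= hnorm ('i *: x - T a x)], so closeness can be tested after
   applying ['i - T a]. *)
apply: (cvg_Total_close yc) => e e0.
apply: filterS (cvg_Total_sub0 wc zc e0) => a; apply: le_lt_trans.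
have [Dr rE] := resolventP (z a) (proj1 (rT (T a))).
apply: le_trans (self_adjoint_hnorm_le _ (udomB Dr (Dya a))) _.
  exact: sop_self_adjoint.
by rewrite lam_subopB // rE.
Qed.
End resolvent_convergence.

Theorem corollary6p4 (R : realType) (X : topologicalType)
    (F : continuous_field R X) (A : Type) (leA : A -> A -> Prop)
    (dA : directed leA) (T : A -> sa_operator F) (Too : sa_operator F) :
  srs_cvg leA T Too <-> G_cvg leA T Too.
Proof. by split; [exact: srs_cvg_G_cvg | exact: G_cvg_srs_cvg]. Qed.
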